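(* For each fixed integer $n\ge 0$, the function $(k,m)\mapsto \mathbf F_n(k,m)$ on pairs of positive integers agrees with a polynomial in $(k,m)$ with coefficients in $\mathbb Q(i)$, of total degree $n+2$.
   Context: Here $i^2=-1$. For integers $n\ge 0$ and $k,m\ge 1$, $\mathbf F_n(k,m)=\sum_{a=1}^{k}\sum_{b=1}^{m}(a+bi)^n\in\mathbb Z[i]$. *)

(* Defs.v *)
From mathcomp Require Import all_boot all_order all_algebra.
From mathcomp Require Import complex mpoly.

Set Implicit Arguments.
Unset Strict Implicit.
Unset Printing Implicit Defensive.
Import Order.TTheory GRing.Theory Num.Theory.
Local Open Scope ring_scope.

(* The field Q(i) is [rat[i]]; the values below lie in its subring Z[i].
   The library gives [int[i]] no ring structure, hence the codomain. *)
Definition gaussian_power_sum (n k m : nat) : rat[i] :=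
  \sum_(1 <= a < k.+1) \sum_(1 <= b < m.+1) (a%:R + b%:R * 'i%C) ^+ n.

(* Main.v *)
Require Import Defs.
From mathcomp Require Import all_boot all_order all_algebra.
From mathcomp Require Import complex mpoly.

Set Implicit Arguments.
Unset Strict Implicit.
Unset Printing Implicit Defensive.
Import Order.TTheory GRing.Theory Num.Theory.
Local Open Scope ring_scope.

(** The values of gaussian_power_sum come from expanding (a + b i)^n by the
    binomial theorem: the double sum separates into
      sum_j C(n, j) i^j S_(n-j)(k) S_j(m),
    where S_r(k) = 1^r + ... + k^r.  Faulhaber's theorem makes each S_r a
    univariate polynomial of degree exactly r + 1, so every summand is a
    polynomial in (k, m) of total degree (n - j + 1) + (j + 1) = n + 2.

    The top-degree parts cannot cancel: the degree in the first variable of the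
    j-th summand is n - j + 1, hence the monomial k^(n+1) m occurs only in the
    summand j = 0, where its coefficient is the product of the leading
    coefficients of S_n and S_0.  Working with coefficients, rather than with
    degrees of products, gives both the bound on the degree and the
    non-cancellation from the one formula mcoeff_separated_product. *)

(** Telescoping (a+1)^(r+1) - a^(r+1) = sum_(j <= r) C(r+1, j) a^j over
    1 <= a <= k gives
      (k+1)^(r+1) - 1 = (r+1) S_r(k) + sum_(j < r) C(r+1, j) S_j(k),
    which determines S_r from the earlier ones, as r + 1 is invertible in
    characteristic 0.  The earlier S_j have degree at most r, so the degree
    of S_r is that of ('X + 1)^(r+1). *)
Lemma faulhaber (F : fieldType) (charF0 : [pchar F] =i pred0) (r : nat) :
  exists S : {poly F},
    size S = r.+2 /\
    forall k : nat, \sum_(1 <= a < k.+1) a%:R ^+ r = S.[k%:R].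
Proof.
have natF0 n : (n%:R == 0 :> F) = (n == 0%N).
  by move/pcharf0P: charF0 => ->.
elim/ltn_ind: r => r IHr.
have {IHr} [S SP] := fin_all_exists (fun j : 'I_r => IHr j (ltn_ord j)).
pose low : {poly F} := 1 + \sum_(j < r) 'C(r.+1, j)%:R *: S j.
have size_low : (size low <= r.+1)%N.
  rewrite (leq_trans (size_polyD _ _)) // geq_max size_poly1 /=.
  apply: (leq_trans (size_sum _ _ _)); apply/bigmax_leqP => j _.
  by rewrite (leq_trans (size_scale_leq _ _)) // (SP j).1 !ltnS.
pose top : {poly F} := ('X + 1) ^+ r.+1.
have size_top : size top = r.+2.
  by rewrite /top -[1]opprK -polyC1 -polyCN size_exp_XsubC.
exists (r.+1%:R^-1 *: (top - low)); split.
  rewrite size_scale ?invr_eq0 ?natF0 // size_polyDl ?size_top //.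
  by rewrite size_polyN ltnS.
move=> k.
have power_gap (a : nat) :
    a.+1%:R ^+ r.+1 - a%:R ^+ r.+1
    = \sum_(j < r.+1) 'C(r.+1, j)%:R * a%:R ^+ j :> F.
  rewrite -[a.+1%:R]natr1 [_ + 1]addrC exprDn big_ord_recr /= subnn expr0.
  rewrite mul1r binn mulr1n addrK; apply: eq_bigr => j _.
  by rewrite expr1n mul1r mulr_natl.
have := @telescope_sumr F 1 k.+1 (fun a => a%:R ^+ r.+1) isT.
rewrite (eq_bigr _ (fun a _ => power_gap a)) exchange_big big_ord_recr /=.
rewrite -!mulr_sumr binSn expr1n => telescoped.
have {telescoped} -> : \sum_(1 <= a < k.+1) a%:R ^+ r
    = r.+1%:R^-1 * (k.+1%:R ^+ r.+1 - 1
        - \sum_(j < r) 'C(r.+1, j)%:R * (S j).[k%:R]) :> F.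
  rewrite -telescoped; under eq_bigr => j _ do rewrite -mulr_sumr (SP j).2.
  by rewrite addrC addrK mulKf ?natF0.
rewrite /top /low !hornerE horner_sum natr1 opprD addrA.
by under [in RHS]eq_bigr => j _ do rewrite hornerZ.
Qed.

(** This is u('X_0) * v('X_1), expanded into monomials so that both its
    coefficients and its values are read off termwise. *)
Definition separated_product (R : comNzRingType) (u v : {poly R}) :
    {mpoly R[2]} :=
  \sum_(a < size u) \sum_(b < size v)
    (u`_a * v`_b) *: 'X_[[multinom [tuple (a : nat); (b : nat)]]].

(** Writing each w`_i as a sum of coefficients against Kronecker deltas turns
    the right-hand side into the same double sum as the left-hand side, also
    for exponents beyond the sizes of u and v. *)
Lemma mcoeff_separated_product (R : comNzRingType) (u v : {poly R})
    (m : 'X_{1.. 2}) :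
  (separated_product u v)@_m = u`_(m ord0) * v`_(m ord_max).
Proof.
have eq_mon (a b : nat) :
    ([multinom [tuple a; b]] == m) = (a == m ord0) && (b == m ord_max).
  apply/eqP/andP => [<- | [/eqP a_m /eqP b_m]].
    by rewrite !mnm_tnth !(tnth_nth 0%N).
  apply/mnmP => i; rewrite mnm_tnth (tnth_nth 0%N) /=.
  case: i => -[|[|//]] lti /=; rewrite ?a_m ?b_m; congr (m _); exact: val_inj.
have coef_trunc (w : {poly R}) (i : nat) :
    w`_i = \sum_(a < size w) w`_a * (val a == i)%:R.
  have [lti | gei] := ltnP i (size w).
    rewrite (bigD1 (Ordinal lti)) //= eqxx mulr1 big1 ?addr0 // => a neq_a.
    by rewrite -val_eqE /= in neq_a; rewrite (negPf neq_a) mulr0.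
  rewrite nth_default // big1 // => a _.
  by rewrite ltn_eqF ?mulr0 // (leq_trans (ltn_ord a)).
rewrite (coef_trunc u) (coef_trunc v) big_distrlr /= raddf_sum.
apply: eq_bigr => a _; rewrite raddf_sum; apply: eq_bigr => b _.
by rewrite /= mcoeffZ mcoeffX eq_mon -mulnb natrM mulrACA.
Qed.

Lemma meval_separated_product (R : comNzRingType) (u v : {poly R}) (x y : R) :
  (separated_product u v).@[tnth [tuple x; y]] = u.[x] * v.[y].
Proof.
rewrite [u.[x]]horner_coef [v.[y]]horner_coef big_distrlr /= raddf_sum.
apply: eq_bigr => a _; rewrite raddf_sum; apply: eq_bigr => b _.
rewrite /= mevalZ mevalX big_ord_recl big_ord1 !mnm_tnth.
by rewrite !(tnth_nth 0) /= mulrACA.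
Qed.

Lemma pchar_complex (R : realFieldType) : [pchar R[i]] =i pred0.
Proof.
apply/pcharf0P => n.
by rewrite -(rmorph_nat (real_complex R)) fmorph_eq0 pnatr_eq0.
Qed.

Lemma gaussian_power_sumE (n k m : nat) :
  gaussian_power_sum n k m
  = \sum_(j < n.+1) ('C(n, j)%:R * 'i%C ^+ j)
      * ((\sum_(1 <= a < k.+1) a%:R ^+ (n - j))
         * (\sum_(1 <= b < m.+1) b%:R ^+ j)).
Proof.
rewrite /gaussian_power_sum.
under eq_bigr => a _ do
  (under eq_bigr => b _ do rewrite exprDn; rewrite exchange_big /=).
rewrite exchange_big /=; apply: eq_bigr => j _.
rewrite big_distrlr mulr_sumr /=; apply: eq_bigr => a _.
rewrite mulr_sumr; apply: eq_bigr => b _.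
rewrite exprMn -mulr_natl -[RHS]mulrA; congr (_ * _).
by rewrite [RHS]mulrCA [_ * 'i%C ^+ j]mulrC.
Qed.

Theorem proposition1 (n : nat) :
  exists p : {mpoly rat[i][2]},
    (msize p).-1 = (n + 2)%N /\
    forall k m : nat, (0 < k)%N -> (0 < m)%N ->
      gaussian_power_sum n k m = p.@[tnth [tuple k%:R; m%:R]].
Proof.
have [S SP] := fin_all_exists
  (fun r : 'I_n.+1 => faulhaber (@pchar_complex rat) r).
have size_S r : size (S r) = r.+2 by have [] := SP r.
have top_coef r : (S r)`_r.+1 != 0.
  by have := lead_coef_eq0 (S r); rewrite lead_coefE -size_poly_eq0 size_S => ->.
pose c (j : nat) : rat[i] := 'C(n, j)%:R * 'i%C ^+ j.
pose p := \sum_(j < n.+1) c j *: separated_product (S (rev_ord j)) (S j).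
have coef_p m : p@_m
    = \sum_(j < n.+1) c j * ((S (rev_ord j))`_(m ord0) * (S j)`_(m ord_max)).
  rewrite raddf_sum; apply: eq_bigr => j _.
  by rewrite /= mcoeffZ mcoeff_separated_product.
have mdeg2 (m : 'X_{1.. 2}) : mdeg m = (m ord0 + m ord_max)%N.
  rewrite mdegE big_ord_recl big_ord1; congr (_ + m _)%N; exact: val_inj.
exists p; split; last first.
  move=> k m _ _; rewrite gaussian_power_sumE raddf_sum.
  apply: eq_bigr => j _; rewrite /= mevalZ meval_separated_product.
  by rewrite -(SP _).2 -(SP _).2 /= subSS.
(* A monomial of degree at least n + 3 has exponent at least n - j + 2 in the
   first variable or at least j + 2 in the second, hence is absent from the
   j-th summand. *)
have upper : (msize p <= n.+3)%N.
  rewrite msizeE; apply/bigmax_leqP_seq => m; rewrite mcoeff_msupp => nz_m _.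
  rewrite ltnS leqNgt mdeg2; apply: contra nz_m => big_m.
  rewrite coef_p big1 // => j _.
  have [lt0 | ge0] := ltnP (m ord0) (n - j).+2; last first.
    by rewrite [(S (rev_ord j))`__]nth_default ?mul0r ?mulr0 // size_S /= subSS.
  rewrite [(S j)`__]nth_default ?mulr0 // size_S.
  move: big_m lt0; have := ltn_ord j; rewrite ltnS => le_jn big_m lt0.
  rewrite -(leq_add2l (m ord0)); apply: leq_trans big_m.
  by rewrite !addnS !ltnS addnC -leq_subRL ?(leqW le_jn) // subSn.
(* For j > 0 the j-th summand has degree at most n in the first variable, so
   only the summand j = 0 contributes to this monomial. *)
pose m0 : 'X_{1.. 2} := [multinom [tuple n.+1; 1%N]].
have lower : (n.+2 < msize p)%N.
  have -> : n.+2 = mdeg m0 by rewrite mdeg2 !mnm_tnth /= addn1.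
  apply: msize_mdeg_lt; rewrite mcoeff_msupp coef_p big_ord_recl big1 => [|j _].
    rewrite addr0 !mnm_tnth !(tnth_nth 0%N) /= /c bin0 mulr1 mul1r.
    have := top_coef (rev_ord ord0); rewrite /= subn1 => ?.
    by rewrite mulf_neq0 ?top_coef.
  rewrite [(S (rev_ord _))`__]nth_default ?mul0r ?mulr0 // size_S.
  rewrite mnm_tnth (tnth_nth 0%N) /= subSS /bump /= add1n.
  by rewrite ltnS subnSK ?ltn_ord // leq_subr.
by rewrite addn2 (eqP (_ : msize p == n.+3)) // eqn_leq upper lower.
Qed.
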